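(* Let $\mathcal{A}$ be a unital $C^*$-algebra, $\mathcal{H}$ a complex Hilbert space, $0\neq P\in\mathscr{B}(\mathcal{H})$ a positive operator with $\ker P\neq\{0\}$, and $\Phi\in\mathrm{CP}^{(P)}(\mathcal{A},\mathscr{B}(\mathcal{H}))$. Let $\mathcal{H}_0:=\overline{\mathrm{range}(P)}$ and, with respect to the decomposition $\mathcal{H}=\mathcal{H}_0\oplus\mathcal{H}_0^\perp$, write $$P=\begin{bmatrix}P_0&0\\0&0\end{bmatrix},\qquad \Phi=\begin{bmatrix}\Phi_0&0\\0&0\end{bmatrix},$$ where $P_0\in\mathscr{B}(\mathcal{H}_0)$ is positive and injective and $\Phi_0\in\mathrm{CP}^{(P_0)}(\mathcal{A},\mathscr{B}(\mathcal{H}_0))$. Then: (i) If $\Phi$ is a $P$-$C^*$-extreme point of $\mathrm{CP}^{(P)}(\mathcal{A},\mathscr{B}(\mathcal{H}))$, then $\Phi_0$ is a $P_0$-$C^*$-extreme point of $\mathrm{CP}^{(P_0)}(\mathcal{A},\mathscr{B}(\mathcal{H}_0))$. (ii) Conversely, if $\dim(\mathcal{H})<\infty$ and $\Phi_0$ is a $P_0$-$C^*$-extreme point of $\mathrm{CP}^{(P_0)}(\mathcal{A},\mathscr{B}(\mathcal{H}_0))$, then $\Phi$ is a $P$-$C^*$-extreme point of $\mathrm{CP}^{(P)}(\mathcal{A},\mathscr{B}(\mathcal{H}))$.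
   Context: $\mathscr{B}(\mathcal{H})$ is the algebra of bounded linear operators on $\mathcal{H}$; $1$ is the unit of $\mathcal{A}$. ''CP'' means completely positive (linear). For $T\in\mathscr{B}(\mathcal{H})$, $\mathrm{Ad}_T(X):=T^*XT$. For a positive operator $P$ on a Hilbert space $\mathcal{H}$, $\mathrm{CP}^{(P)}(\mathcal{A},\mathscr{B}(\mathcal{H}))$ is the set of all CP maps $\Phi:\mathcal{A}\to\mathscr{B}(\mathcal{H})$ with $\Phi(1)=P$. A map $\Phi\in\mathrm{CP}^{(P)}(\mathcal{A},\mathscr{B}(\mathcal{H}))$ is a $P$-$C^*$-extreme point of this set if whenever $\Phi=\sum_{j=1}^n\mathrm{Ad}_{T_j}\circ\Phi_j$ with $n\ge 1$, $\Phi_j\in\mathrm{CP}^{(P)}(\mathcal{A},\mathscr{B}(\mathcal{H}))$ and $T_j\in\mathscr{B}(\mathcal{H})$ invertible with $\sum_{j=1}^nT_j^*PT_j=P$, there exist invertible $S_j\in\mathscr{B}(\mathcal{H})$ such that $\Phi_j=\mathrm{Ad}_{S_j}\circ\Phi$ for all $1\leq j\leq n$. The block form of $\Phi\in\mathrm{CP}^{(P)}(\mathcal{A},\mathscr{B}(\mathcal{H}))$ displayed in the claim always exists: $P_0$ and $\Phi_0(a)$ are the compressions of $P$ and $\Phi(a)$ to $\mathcal{H}_0$, and all other blocks of $\Phi(a)$ vanish. *)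

(* Defs.v *)
From HB Require Import structures.
From mathcomp Require Import all_boot all_order all_algebra.
From mathcomp Require Import complex ring lra.
From mathcomp Require Import all_classical reals topology normedtype.

Set Implicit Arguments.
Unset Strict Implicit.
Unset Printing Implicit Defensive.

Import Order.TTheory GRing.Theory Num.Theory.
Import numFieldNormedType.Exports.

Local Open Scope classical_set_scope.
Local Open Scope ring_scope.

HB.mixin Record CompleteNormedModule_isHilbert (R : realType) H
    & CompleteNormedModule R[i] H := {
  dotp : H -> H -> R[i] ;
  dotpPl : forall (a : R[i]) x y z,
    dotp (a *: x + y) z = a * dotp x z + dotp y z ;
  dotpC : forall x y, dotp y x = (dotp x y)^* ;
  dotpxx : forall x, dotp x x = `|x| ^+ 2
}.

#[short(type="hilbertType")]
HB.structure Definition Hilbert (R : realType) :=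
  {H of CompleteNormedModule R[i] H & CompleteNormedModule_isHilbert R H}.

(* The library has no join of ring and normed-module structures, and none can
   be added after the fact, so the norm of a C*-algebra is carried explicitly.
   As in a normedModType R[i], it takes its values in the nonnegative reals
   of R[i]. *)
HB.mixin Record Algebra_isCStar (R : realType) A & GRing.Algebra R[i] A := {
  star : A -> A ;
  starK : involutive star ;
  starP : forall (c : R[i]) a b, star (c *: a + b) = c^* *: star a + star b ;
  starM : forall a b, star (a * b) = star b * star a ;
  cnorm : A -> R[i] ;
  cnormD : forall a b, cnorm (a + b) <= cnorm a + cnorm b ;
  cnormZ : forall (c : R[i]) a, cnorm (c *: a) = `|c| * cnorm a ;
  cnorm0_eq0 : forall a, cnorm a = 0 -> a = 0 ;
  cnormM : forall a b, cnorm (a * b) <= cnorm a * cnorm b ;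
  cnorm_star : forall a, cnorm (star a * a) = cnorm a ^+ 2 ;
  cnorm_complete : forall u : nat -> A,
    (forall e : R[i], 0 < e -> exists N, forall m n,
      (N <= m)%N -> (N <= n)%N -> cnorm (u m - u n) < e) ->
    exists l, forall e : R[i], 0 < e -> exists N, forall n,
      (N <= n)%N -> cnorm (u n - l) < e
}.

#[short(type="cstarAlgType")]
HB.structure Definition CStarAlgebra (R : realType) :=
  {A of GRing.Algebra R[i] A & Algebra_isCStar R A}.

Section InnerProduct.
Variables (R : realType) (H : hilbertType R).
Implicit Types (x y z : H) (a : R[i]).

Lemma dotpDl x y z : dotp (x + y) z = dotp x z + dotp y z.
Proof. by rewrite -[x in LHS]scale1r dotpPl mul1r. Qed.

Lemma dotp0l z : dotp 0 z = 0.
Proof. by apply: (addrI (dotp 0 z)); rewrite -dotpDl !addr0. Qed.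

Lemma dotpZl a x z : dotp (a *: x) z = a * dotp x z.
Proof. by rewrite -[a *: x]addr0 dotpPl dotp0l addr0. Qed.

Lemma dotpNl x z : dotp (- x) z = - dotp x z.
Proof. by rewrite -scaleN1r dotpZl mulN1r. Qed.

Lemma dotpBl x y z : dotp (x - y) z = dotp x z - dotp y z.
Proof. by rewrite dotpDl dotpNl. Qed.

Lemma dotpDr x y z : dotp x (y + z) = dotp x y + dotp x z.
Proof. by rewrite dotpC dotpDl rmorphD /= -!dotpC. Qed.

Lemma dotpZr a x z : dotp x (a *: z) = a^* * dotp x z.
Proof. by rewrite dotpC dotpZl rmorphM /= -dotpC. Qed.

Lemma dotp0r z : dotp z 0 = 0.
Proof. by rewrite dotpC dotp0l rmorph0. Qed.

Lemma dotpNr x z : dotp x (- z) = - dotp x z.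
Proof. by rewrite -scaleN1r dotpZr rmorphN rmorph1 mulN1r. Qed.

Lemma dotpBr x y z : dotp x (y - z) = dotp x y - dotp x z.
Proof. by rewrite dotpDr dotpNr. Qed.

Lemma dotp_eq0 x : (forall y, dotp x y = 0) -> x = 0.
Proof.
by move/(_ x); rewrite dotpxx => /eqP; rewrite sqrf_eq0 normr_eq0 => /eqP.
Qed.

Lemma dotp_inj x y : (forall z, dotp z x = dotp z y) -> x = y.
Proof.
move=> xy; apply/eqP; rewrite -subr_eq0; apply/eqP/dotp_eq0 => z.
by rewrite dotpC dotpBr xy subrr rmorph0.
Qed.

Lemma pythagoras x y : dotp x y = 0 -> `|x + y| ^+ 2 = `|x| ^+ 2 + `|y| ^+ 2.
Proof.
move=> xy; rewrite -!dotpxx dotpDl !dotpDr xy (dotpC x y) xy rmorph0.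
by rewrite addr0 add0r.
Qed.

Lemma parallelogram x y :
  `|x + y| ^+ 2 + `|x - y| ^+ 2 = 2 * (`|x| ^+ 2 + `|y| ^+ 2).
Proof.
rewrite -!dotpxx !dotpDl !dotpDr !dotpNl !dotpNr opprK.
by rewrite mulrDr ![2 * _]mulr_natl !mulr2n addrACA; congr (_ + _);
   rewrite ?[_ + dotp y y]addrC addrACA ?[- _ + _]addrC subrr ?addr0 ?add0r.
Qed.

Lemma dotp_residue x y : y != 0 ->
  `|x - (dotp x y / `|y| ^+ 2) *: y| ^+ 2
    = `|x| ^+ 2 - `|dotp x y| ^+ 2 / `|y| ^+ 2.
Proof.
move=> y0; set c := _ / _.
have ny : `|y| ^+ 2 != 0 by rewrite sqrf_eq0 normr_eq0.
have ort : dotp (x - c *: y) (c *: y) = 0.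
  by rewrite dotpBl !dotpZr dotpZl dotpxx /c divfK // subrr.
have := pythagoras ort; rewrite subrK => ->.
suff -> : `|c *: y| ^+ 2 = `|dotp x y| ^+ 2 / `|y| ^+ 2 by rewrite addrK.
rewrite normrZ exprMn /c normrM exprMn normfV normrX normr_id.
by rewrite exprVn -mulrA [_^-1 * _]mulrC [(_ ^+ 2) ^+ 2]expr2 invfM mulVKf.
Qed.

Lemma cauchy_schwarz x y : `|dotp x y| <= `|x| * `|y|.
Proof.
have [->|y0] := eqVneq y 0; first by rewrite dotp0r !normr0 mulr0.
have yp : 0 < `|y| ^+ 2 by rewrite exprn_gt0 ?normr_gt0.
rewrite -(@ler_pXn2r _ 2) ?nnegrE ?mulr_ge0 // exprMn -ler_pdivrMr //.
by rewrite -subr_ge0 -dotp_residue // exprn_ge0.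
Qed.

End InnerProduct.

Section BoundedOperators.
Variables (R : realType) (H : hilbertType R).

Definition bounded_linear : {pred H -> H} := [pred f : H -> H |
  `[< linear f /\ exists M : R[i], forall x, `|f x| <= M * `|x| >]].

Lemma bounded_linearP (f : H -> H) : reflect
  (linear f /\ exists M : R[i], forall x, `|f x| <= M * `|x|)
  (f \in bounded_linear).
Proof. exact: asboolP. Qed.

Lemma bounded_linear_submod : submod_closed bounded_linear.
Proof.
split=> [|a f g /bounded_linearP[lf [M fM]] /bounded_linearP[lg [N gN]]].
  apply/bounded_linearP; split=> [a x y|]; first by rewrite scaler0 addr0.
  by exists 0 => x; rewrite normr0 mul0r.
apply/bounded_linearP; split=> [b x y|].
  rewrite -![(a *: f + g) _]/(a *: f _ + g _) lf lg.
  by rewrite !scalerDr !scalerA [a * b]mulrC addrACA.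
exists (`|a| * M + N) => x; rewrite -[(a *: f + g) x]/(a *: f x + g x).
rewrite (le_trans (ler_normD _ _)) // normrZ mulrDl lerD // -mulrA.
by rewrite ler_wpM2l.
Qed.

HB.instance Definition _ := GRing.isSubmodClosed.Build R[i] (H -> H)
  bounded_linear bounded_linear_submod.

Record bop := Bop { bop_fun :> H -> H ; _ : bop_fun \in bounded_linear }.

HB.instance Definition _ := [isSub for bop_fun].
HB.instance Definition _ := [Choice of bop by <:].
HB.instance Definition _ := [SubChoice_isSubLmodule of bop by <:].

End BoundedOperators.

Section BoundedOperatorTheory.
Variables (R : realType) (H : hilbertType R).
Implicit Types S T X : bop H.

Lemma bop_linear T : linear T.
Proof. by case: T => T /= /bounded_linearP[]. Qed.

HB.instance Definition _ T :=
  GRing.isLinear.Build R[i] H H *:%R (bop_fun T) (bop_linear T).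

Lemma bop_bounded T : exists M : R[i], forall x, `|T x| <= M * `|x|.
Proof. by case: T => T /= /bounded_linearP[]. Qed.

Lemma bop_eq S T : S =1 T -> S = T.
Proof. by move=> ST; apply/val_inj/funext. Qed.

Lemma bopD S T x : (S + T) x = S x + T x. Proof. by []. Qed.
Lemma bopZ (a : R[i]) T x : (a *: T) x = a *: T x. Proof. by []. Qed.

Fact bop_comp_subproof S T : (fun x => S (T x)) \in @bounded_linear R H.
Proof.
apply/bounded_linearP; split=> [a x y|]; first by rewrite !linearP.
have [M SM] := bop_bounded S; have [N TN] := bop_bounded T.
exists (`|M| * N) => x; rewrite (le_trans (SM _)) //.
apply: (@le_trans _ _ (`|M| * `|T x|)); last by rewrite -mulrA ler_wpM2l.
have [->|Tx0] := eqVneq (T x) 0; first by rewrite normr0 !mulr0.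
have M0 : 0 <= M.
  by have := le_trans (normr_ge0 _) (SM (T x)); rewrite pmulr_lge0 ?normr_gt0.
by rewrite ger0_norm.
Qed.

Definition bop_comp S T : bop H := Bop (bop_comp_subproof S T).

Definition is_adjoint T S := forall x y, dotp (T x) y = dotp x (S y).

(* The default 0 is never taken: see adjointP and adjoint_uniq below. *)
Definition adjoint T : bop H := xget 0 [set S | is_adjoint T S].

Definition Ad T X : bop H := bop_comp (adjoint T) (bop_comp X T).

Definition op_invertible T := exists S, cancel T S /\ cancel S T.

Definition op_positive T := forall x, 0 <= dotp (T x) x.

End BoundedOperatorTheory.

Section ClosedSubspaces.
Variables (R : realType) (H : hilbertType R).

Record closedSubspace := ClosedSubspace {
  csub_set : set H ;
  csub_submod : submod_closed [pred x | x \in csub_set] ;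
  csub_closed : closed csub_set
}.
Variable S : closedSubspace.

Definition csub_pred : {pred H} := [pred x | x \in csub_set S].

HB.instance Definition _ := GRing.isSubmodClosed.Build R[i] H
  csub_pred (csub_submod S).

Record csub := Csub { csub_val :> H ; _ : csub_val \in csub_pred }.

HB.instance Definition _ := [isSub for csub_val].
HB.instance Definition _ := [Choice of csub by <:].
HB.instance Definition _ := [SubChoice_isSubLmodule of csub by <:].

Let nrm (x : csub) := `|val x|.
Fact csub_normD x y : nrm (x + y) <= nrm x + nrm y.
Proof. exact: ler_normD. Qed.
Fact csub_normZ (a : R[i]) x : nrm (a *: x) = `|a| * nrm x.
Proof. exact: normrZ. Qed.
Fact csub_norm0_eq0 x : nrm x = 0 -> x = 0.
Proof. by move/normr0_eq0 => x0; apply/val_inj. Qed.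

HB.instance Definition _ := @Lmodule_isNormed.Build R[i] csub nrm
  csub_normD csub_normZ csub_norm0_eq0.

Lemma csub_normE (x : csub) : `|x| = `|val x|.
Proof. by []. Qed.

End ClosedSubspaces.

Section ClosedSubspaceHilbert.
Variables (R : realType) (H : hilbertType R) (S : closedSubspace H).

Lemma csub_complete (F : set_system (csub S)) :
  ProperFilter F -> cauchy F -> cvg F.
Proof.
move=> FF /cauchyP Fc.
pose G := (val : csub S -> H) @ F.
have Gc : cauchy G.
  apply: cauchy_exP => e e0; have [x Fx] := Fc e e0; exists (val x).
  rewrite /G /= nbhs_simpl; apply: filterS Fx => y.
  by rewrite -!ball_normE.
have Gl : cvg G by exact: cauchy_cvg.
have Sl : csub_set S (lim G).
  apply: (@closed_cvg _ _ F _ val (csub_set S) (@csub_closed _ _ S) _ _ Gl).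
  by apply: nearW => -[x xS] /=; exact: set_mem xS.
apply/cvg_ex; exists (Csub (mem_set Sl) : csub S).
apply/(@cvgrPdist_lt _ _ _ F _ id) => e e0.
by move/cvgrPdist_lt: Gl => /(_ e e0).
Qed.

HB.instance Definition _ := Uniform_isComplete.Build (csub S) csub_complete.

Let csub_dotp (x y : csub S) : R[i] := dotp (val x) (val y).

Fact csub_dotpP (a : R[i]) x y z :
  csub_dotp (a *: x + y) z = a * csub_dotp x z + csub_dotp y z.
Proof. exact: dotpPl. Qed.
Fact csub_dotpC x y : csub_dotp y x = (csub_dotp x y)^*.
Proof. exact: dotpC. Qed.
Fact csub_dotpxx x : csub_dotp x x = `|x| ^+ 2.
Proof. exact: dotpxx. Qed.

HB.instance Definition _ := CompleteNormedModule_isHilbert.Build R (csub S)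
  csub_dotpP csub_dotpC csub_dotpxx.

End ClosedSubspaceHilbert.

Section Projection.
Variables (R : realType) (H : hilbertType R) (S : closedSubspace H).
Implicit Types (x : H) (y z : csub S).

Definition is_orthproj x y := forall z, dotp (x - val y) (val z) = 0.

Lemma min_dist_orthproj x y :
  (forall z, `|x - val y| <= `|x - val z|) -> is_orthproj x y.
Proof.
move=> ymin z; have [->|z0] := eqVneq (val z) 0; first by rewrite dotp0r.
set u := x - val y; set c := dotp u (val z) / `|val z| ^+ 2.
have : `|u| ^+ 2 <= `|u - c *: val z| ^+ 2.
  rewrite ler_pXn2r ?nnegrE //.
  by have := ymin (y + c *: z); rewrite /u /= -addrA -opprD.
have zp : 0 < `|val z| ^+ 2 by rewrite exprn_gt0 ?normr_gt0.
rewrite /c dotp_residue // lerBrDr gerDl pmulr_lle0 ?invr_gt0 //.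
move=> le0; apply/eqP; rewrite -normr_eq0 -sqrf_eq0 eq_le le0 /=.
exact: exprn_ge0.
Qed.

Lemma min_dist_exists x : exists y, forall z, `|x - val y| <= `|x - val z|.
Proof.
pose q z : R := complex.Re `|x - val z|.
have qE z : (q z)%:C%C = `|x - val z|.
  rewrite /q; have := normr_ge0 (x - val z).
  by case: `|_| => a b; rewrite lecE /= => /andP[/eqP -> _].
pose d := inf (range q).
have q0 z : 0 <= q z by rewrite -ler0c qE.
have hlb : has_lbound (range q) by exists 0 => _ [z _ <-].
have hinf : has_inf (range q) by split=> //; exists (q 0); exists 0.
have dq z : d <= q z by apply: ge_inf => //; exists z.
have d0 : 0 <= d.
  by apply: lb_le_inf; [exists (q 0); exists 0 | move=> _ [z _ <-]].
have dlt e : 0 < e -> exists z, q z < d + e.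
  by move=> e0; have [_ [z _ <-] ?] := inf_adherent e0 hinf; exists z.
pose B (e : R) := [set z | q z < d + e].
pose F := filter_from [set e : R | 0 < e] B.
have FF : ProperFilter F.
  apply: filter_from_proper => [|e /= /dlt[z ?]]; last by exists z.
  apply: filter_from_filter; first by exists 1 => /=.
  move=> e f /= e0 f0; exists (Num.min e f) => /=.
    by rewrite lt_min e0 f0.
  move=> z; rewrite /B /= => zef.
  split; apply: lt_le_trans zef _; rewrite lerD2l ge_min lexx ?orbT //.
have mid z w (e : R) : 0 < e -> q z < d + e -> q w < d + e ->
    `|z - w| ^+ 2 <= (4 * (e * (2 * d + e)))%:C%C.
  move=> e0 ze we; rewrite distrC csub_normE.
  have := parallelogram (x - val z) (x - val w).
  have -> : x - val z - (x - val w) = val (w - z).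
    by rewrite opprB addrC addrA subrK.
  have -> : x - val z + (x - val w) = 2 *: (x - val (2^-1 *: (z + w))).
    rewrite scalerBr /= scalerA divff ?pnatr_eq0 // scale1r.
    by rewrite scaler_nat mulr2n addrACA opprD.
  rewrite normrZ -!qE ger0_norm ?ler0n // exprMn.
  set t := q _ => E.
  have -> : `|val (w - z)| ^+ 2 = (2 * (q z ^+ 2 + q w ^+ 2) - 4 * t ^+ 2)%:C%C.
    rewrite rmorphB [X in _ = X - _]rmorphM [X in _ = _ - X]rmorphM.
    rewrite [X in _ = _ * X - _]rmorphD.
    by rewrite !rmorphXn !rmorph_nat /= -E -natrX [X in _ = X - _]addrC addrK.
  rewrite lecR.
  have tz : d ^+ 2 <= t ^+ 2 by rewrite ler_pXn2r ?nnegrE ?dq ?q0.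
  have zz : q z ^+ 2 <= (d + e) ^+ 2.
    by rewrite ler_pXn2r ?nnegrE ?q0 ?(ltW ze) ?addr_ge0 ?(ltW e0).
  have ww : q w ^+ 2 <= (d + e) ^+ 2.
    by rewrite ler_pXn2r ?nnegrE ?q0 ?(ltW we) ?addr_ge0 ?(ltW e0).
  apply: (@le_trans _ _ (2 * ((d + e) ^+ 2 + (d + e) ^+ 2) - 4 * d ^+ 2)).
    by rewrite lerB ?ler_wpM2l ?lerD.
  by rewrite le_eqVlt; apply/orP; left; apply/eqP; ring.
have Fc : cauchy F.
  apply: cauchy_exP => e; case: e => a b; rewrite ltcE /= => /andP[/eqP -> a0].
  pose e := Num.min 1 (a ^+ 2 / (4 * (2 * d + 1) + 1)).
  have den0 : 0 < 4 * (2 * d + 1) + 1 :> R.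
    by rewrite ltr_wpDl // mulr_ge0 ?addr_ge0 ?mulr_ge0.
  have e0 : 0 < e by rewrite lt_min ltr01 divr_gt0 ?exprn_gt0.
  have [z ze] := dlt _ e0; exists z; exists e => //= w we.
  have ap : 0 <= (a +i* 0)%C by rewrite lecE /= eqxx ltW.
  rewrite -ball_normE /= -(@ltr_pXn2r _ 2) ?nnegrE ?normr_ge0 ?ap //.
  apply: le_lt_trans (mid _ _ _ e0 ze we) _.
  have e1 : e <= 1 by rewrite ge_min lexx.
  have e2 : e * (4 * (2 * d + 1) + 1) <= a ^+ 2.
    by rewrite -ler_pdivlMr // ge_min lexx orbT.
  rewrite -[(a +i* 0)%C]/(a%:C%C) -rmorphXn /= ltcR.
  apply: lt_le_trans e2.
  nra.
have Fl : cvg F by exact: cauchy_cvg.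
exists (lim F).
have qd : `|x - val (lim F)| <= d%:C%C.
  rewrite -qE lecR; apply/ler_addgt0Pr => e e0.
  have e20 : 0 < e / 2 by rewrite divr_gt0.
  have : 0 < (e / 2)%:C%C :> R[i] by rewrite ltcR.
  move: Fl => /(@cvgrPdist_lt _ _ _ F _ id)/[apply] Fl.
  have FB : F (B (e / 2)) by exists (e / 2).
  have [z [/= lz Bz]] := filter_ex (filterI Fl FB).
  rewrite -lecR qE.
  have -> : x - val (lim F) = (x - val z) - val (lim F - z).
    by rewrite /= opprB addrA subrK.
  rewrite (le_trans (ler_normB _ _)) // (splitr e) addrA rmorphD /= lerD //.
    by rewrite -qE lecR; exact: ltW.
  exact: ltW.
by move=> z; apply: le_trans qd _; rewrite -qE lecR.
Qed.

Lemma orthproj_exists x : exists y, is_orthproj x y.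
Proof. by have [y /min_dist_orthproj] := min_dist_exists x; exists y. Qed.

(* The default 0 is never taken: see orthprojP. *)
Definition orthproj x : csub S := xget 0 [set y | is_orthproj x y].

Lemma orthprojP x : is_orthproj x (orthproj x).
Proof. by apply: xgetPex; exact: orthproj_exists. Qed.

Lemma orthproj_uniq x y : is_orthproj x y -> orthproj x = y.
Proof.
move=> xy; apply/eqP; rewrite -subr_eq0; apply/eqP/dotp_eq0 => z.
rewrite -[dotp _ _]/(dotp (val (orthproj x - y)) (val z)).
have -> : val (orthproj x - y) = (x - val y) - (x - val (orthproj x)).
  by rewrite opprB [RHS]addrC addrA subrK.
by rewrite dotpBl xy orthprojP subrr.
Qed.

Lemma orthproj_linear : linear orthproj.
Proof.
move=> a x x'; apply: orthproj_uniq => z.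
rewrite [val (_ + _)]/= opprD addrACA -scalerBr dotpDl dotpZl.
by rewrite !orthprojP mulr0 addr0.
Qed.

Lemma orthproj_norm x : `|orthproj x| <= `|x|.
Proof.
rewrite -(@ler_pXn2r _ 2) ?nnegrE // csub_normE.
rewrite -[X in _ <= `|X| ^+ 2](subrK (val (orthproj x))).
by rewrite pythagoras ?orthprojP // lerDr exprn_ge0.
Qed.

Fact compress_subproof (T : bop H) :
  (fun y : csub S => orthproj (T (val y))) \in @bounded_linear R (csub S).
Proof.
apply/bounded_linearP; split=> [a y z|].
  by rewrite [val (_ + _)]/= linearP orthproj_linear.
have [M TM] := bop_bounded T; exists M => y.
exact: le_trans (orthproj_norm _) (TM _).
Qed.

(* The upper left block of T for the decomposition of H into S and its
   orthogonal complement. *)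
Definition compress (T : bop H) : bop (csub S) := Bop (compress_subproof T).

Lemma compress_linear : linear compress.
Proof. by move=> a T X; apply: bop_eq => y /=; rewrite orthproj_linear. Qed.

HB.instance Definition _ :=
  GRing.isLinear.Build R[i] (bop H) (bop (csub S)) *:%R compress compress_linear.

End Projection.

Section Adjoint.
Variables (R : realType) (H : hilbertType R).
Implicit Types (x y : H) (T : bop H).

Section Riesz.
Variables (f : {linear H -> R[i]^o}) (M : R[i]).
Hypotheses (M0 : 0 <= M) (fM : forall x, `|f x| <= M * `|x|).

Let ker : set H := [set x | f x = 0].

Let ker_submod : submod_closed [pred x | x \in ker].
Proof.
split=> [|a x y]; rewrite !inE; first exact: linear0.
by rewrite /ker /= linearP => -> ->; rewrite scaler0 addr0.
Qed.

Let ker_closed : closed ker.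
Proof.
move=> x clx; apply/eqP; rewrite -normr_le0; apply/ler_addgt0Pl => e e0.
have M1 : 0 < M + 1 by rewrite ltr_wpDl.
have [y [fy]] := clx _ (nbhsx_ballx x _ (divr_gt0 e0 M1)).
rewrite -ball_normE /= => xy; rewrite addr0.
have -> : f x = f (x - y) by rewrite linearB fy subr0.
rewrite (le_trans (fM _)) // (le_trans (ler_wpM2l M0 (ltW xy))) //.
by rewrite mulrCA ger_pMr // ler_pdivrMr // mul1r lerDl.
Qed.

Lemma riesz : exists v, forall x, f x = dotp x v.
Proof.
pose S := ClosedSubspace ker_submod ker_closed.
have [f0|] := pselect (forall x, f x = 0).
  by exists 0 => x; rewrite dotp0r f0.
move/existsNP => [x0 /eqP fx0]; pose u := x0 - val (orthproj S x0).
have fu : f u = f x0.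
  by rewrite linearB; case: (orthproj S x0) => /= s /set_mem ->; rewrite subr0.
have fu0 : f u != 0 by rewrite fu.
have u0 : `|u| ^+ 2 != 0.
  rewrite sqrf_eq0 normr_eq0; apply: contra_neq fu0 => ->; exact: linear0.
exists (((f u)^* / `|u| ^+ 2) *: u) => x.
have zk : f (x - (f x / f u) *: u) = 0.
  rewrite linearB linearZ /= -[_ *: f u]/(f x / f u * f u) divfK ?subrr //.
have := @orthprojP _ _ S x0 (Csub (mem_set zk : _ \in @csub_pred _ _ S)).
rewrite -/u /= dotpC dotpBl dotpZl dotpxx => /eqP; rewrite conjC_eq0 subr_eq0.
rewrite dotpZr => /eqP ->.
rewrite rmorphM fmorphV rmorphXn /= conjCK (CrealP (normr_real _)).
by rewrite mulrCA -!mulrA; field; rewrite fu0 -sqrf_eq0 u0.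
Qed.

End Riesz.

Lemma adjoint_exists T : exists S : bop H, is_adjoint T S.
Proof.
have [M TM] := bop_bounded T.
pose N := `|M|; have TN x : `|T x| <= N * `|x|.
  have [->|x0] := eqVneq x 0; first by rewrite linear0 !normr0 mulr0.
  have : 0 <= M.
    by have := le_trans (normr_ge0 _) (TM x); rewrite pmulr_lge0 ?normr_gt0.
  by rewrite /N => /ger0_norm ->.
have N0 : 0 <= N by exact: normr_ge0.
have ex y : exists v, forall x, dotp (T x) y = dotp x v.
  have lin : linear (fun x => dotp (T x) y : R[i]^o).
    by move=> a x x'; rewrite linearP dotpPl.
  pose f : {linear H -> R[i]^o} :=
    HB.pack (fun x => dotp (T x) y : R[i]^o) (GRing.isLinear.Build _ _ _ _ _ lin).
  apply: (@riesz f (N * `|y|)) => [|x]; first exact: mulr_ge0.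
  by rewrite (le_trans (cauchy_schwarz _ _)) // mulrAC ler_wpM2r.
have [S TS] := choice ex.
have SP : S \in @bounded_linear R H.
  apply/bounded_linearP; split=> [a x y|].
    by apply: dotp_inj => z; rewrite -TS !dotpDr !dotpZr !TS.
  exists N => x; have [->|Sx0] := eqVneq (S x) 0.
    by rewrite normr0 mulr_ge0.
  rewrite -(@ler_pM2r _ `|S x|) ?normr_gt0 // -expr2 -dotpxx -TS.
  rewrite -[leLHS]ger0_norm; last by rewrite TS dotpxx exprn_ge0.
  by rewrite (le_trans (cauchy_schwarz _ _)) // mulrAC ler_wpM2r.
by exists (Bop SP) => x y; rewrite TS.
Qed.

Lemma adjointP T : is_adjoint T (adjoint T).
Proof. by apply: (@xgetPex _ _ [set S | is_adjoint T S]); exact: adjoint_exists. Qed.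

Lemma adjoint_uniq T S : is_adjoint T S -> adjoint T = S.
Proof.
move=> TS; apply: bop_eq => y; apply: dotp_inj => x.
by rewrite -TS adjointP.
Qed.

End Adjoint.

Section RangeClosure.
Variables (R : realType) (H : hilbertType R) (P : bop H).

Fact range_closure_submod :
  submod_closed [pred x | x \in closure (range P)].
Proof.
split=> [|a x y].
  by rewrite inE; apply: subset_closure; exists 0 => //; exact: linear0.
move=> /set_mem clx /set_mem cly; apply/mem_set => B /nbhs_ballP[e /= e0 eB].
have e2 : 0 < e / 2 by rewrite divr_gt0.
have a1 : 0 < `|a| + 1 by rewrite ltr_wpDl.
have [_ [[x' _ <-]]] := clx _ (nbhsx_ballx x _ (divr_gt0 e2 a1)).
have [_ [[y' _ <-]]] := cly _ (nbhsx_ballx y _ e2).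
rewrite -!ball_normE /= => yy xx.
exists (P (a *: x' + y')); split; first by exists (a *: x' + y').
apply: eB; rewrite -ball_normE /= linearP opprD addrACA -scalerBr.
rewrite (le_lt_trans (ler_normD _ _)) // (splitr e) ler_ltD //.
rewrite normrZ (le_trans (ler_wpM2l _ (ltW xx))) //.
by rewrite mulrCA ger_pMr // ler_pdivrMr // mul1r lerDl.
Qed.

Definition range_closure : closedSubspace H :=
  ClosedSubspace range_closure_submod (@closed_closure _ (range P)).

End RangeClosure.

Section CompletelyPositive.
Variables (R : realType) (A : cstarAlgType R) (H : hilbertType R).
Implicit Types (n : nat) (P : bop H) (Phi : {linear A -> bop H}).

Definition mxstar n (b : 'M[A]_n) : 'M[A]_n := \matrix_(i, j) star (b j i).

(* In the C*-algebra M_n(A) the positive elements are the products b^* b. *)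
Definition mx_positive n (a : 'M[A]_n) := exists b, a = mxstar b *m b.

(* M_n(B(H)) is identified with the bounded operators on H^n. *)
Definition opmx_positive n (T : 'M[bop H]_n) := forall x : 'I_n -> H,
  0 <= \sum_(i < n) \sum_(j < n) dotp (T i j (x j)) (x i).

Definition completely_positive Phi := forall n (a : 'M[A]_n),
  mx_positive a -> opmx_positive (map_mx Phi a).

Definition CP P : set {linear A -> bop H} :=
  [set Phi | completely_positive Phi /\ Phi 1 = P].

Definition Cstar_extreme P Phi := CP P Phi /\
  forall n (Phis : 'I_n -> {linear A -> bop H}) (T : 'I_n -> bop H),
    (0 < n)%N ->
    (forall j, CP P (Phis j)) ->
    (forall j, op_invertible (T j)) ->
    \sum_(j < n) Ad (T j) P = P ->
    (forall a, Phi a = \sum_(j < n) Ad (T j) (Phis j a)) ->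
  exists S : 'I_n -> bop H, forall j,
    op_invertible (S j) /\ forall a, Phis j a = Ad (S j) (Phi a).

End CompletelyPositive.

Definition finite_dimensional (R : realType) (H : hilbertType R) :=
  exists n (e : 'I_n -> H), forall x, exists c : 'I_n -> R[i],
    x = \sum_(i < n) c i *: e i.

(* Main.v *)
(* Positivity of Phi on the
   matrices [[1, a], [a^*, a^* a]] forces every Phi a to be X + 0 in the
   decomposition of H, so that Phi and Phi0 determine each other. For (i), the
   data T_j, Phi_j on H0 extend to T_j + 1, Phi_j + 0 on H. For (ii), and to
   come back in (i), operators T on H are compressed to H0. The point is that
   the compression stays invertible: the upper right block b of T satisfies
   b^* P0 b = 0, hence b = 0 as P0 is injective, so the upper left block a has
   a right inverse. It is injective in (i) because a^* P0 a = P0, and in (ii)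
   because dim H0 is finite. *)
From HB Require Import structures.
Require Import Defs.
From mathcomp Require Import all_boot all_order all_algebra.
From mathcomp Require Import complex.
From mathcomp Require Import all_classical reals topology normedtype.

Set Implicit Arguments.
Unset Strict Implicit.
Unset Printing Implicit Defensive.

Import Order.TTheory GRing.Theory Num.Theory.
Import numFieldNormedType.Exports.

Local Open Scope classical_set_scope.
Local Open Scope ring_scope.

(** * Affine functions of a scalar that stay nonnegative *)

Lemma real_line_ge0_slope0 (K : numFieldType) (c w : K) :
  (forall r, r \is Num.real -> 0 <= c + r * w) -> w = 0.
Proof.
move=> pos; have c0 : 0 <= c by have := pos 0 (rpred0 _); rewrite mul0r addr0.
have wr : w \is Num.real.
  have := ger0_real (pos 1 (rpred1 _)).
  by rewrite mul1r addrC rpredDr // ger0_real.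
apply/eqP/negP => /negP w0.
(* At this argument the affine function takes the value -1. *)
have : - (c + 1) / w \is Num.real.
  by rewrite realM ?realV // realN realD ?real1 // ger0_real.
by move/pos; rewrite divfK // opprD addrA subrr sub0r oppr_ge0 ler10.
Qed.

(** Real [t] give [u + v = 0], purely imaginary [t] give [v - u = 0]. *)
Lemma affine_conj_ge0 (K : numClosedFieldType) (c u v : K) :
  (forall t, 0 <= c + (t^* * u + t * v)) -> u = 0 /\ v = 0.
Proof.
move=> pos.
have /eqP uv : u + v = 0.
  apply: (@real_line_ge0_slope0 _ c) => r /CrealP rr.
  by rewrite mulrDr -{1}rr.
have /eqP : 'i * (v - u) = 0.
  apply: (@real_line_ge0_slope0 _ c) => r /CrealP rr.
  have := pos (r * 'i); rewrite rmorphM /= rr conjCi.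
  by rewrite !mulrBr !mulrA addrC mulrN mulNr [- _ + _]addrC addrC.
rewrite mulf_eq0 (negPf (neq0Ci _)) /= subr_eq0 => /eqP vu.
move: uv; rewrite vu -mulr2n mulrn_eq0 /= => /eqP u0.
by rewrite u0.
Qed.

(** * Sesquilinear forms of operators, kernels of positive operators *)

Section Operators.
Variables (R : realType) (H : hilbertType R).
Implicit Types (x y : H) (S T X Y P : bop H).

Lemma bop_dotp_eq X Y : (forall x y, dotp (X x) y = dotp (Y x) y) -> X = Y.
Proof.
move=> XY; apply: bop_eq => x; apply: dotp_inj => z.
by rewrite dotpC XY -dotpC.
Qed.

Lemma dotp_Ad T X x y : dotp (Ad T X x) y = dotp (X (T x)) (T y).
Proof. by rewrite [LHS]dotpC -adjointP -dotpC. Qed.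

Lemma dotp_sum n (F : 'I_n -> bop H) x y :
  dotp ((\sum_(j < n) F j) x) y = \sum_(j < n) dotp (F j x) y.
Proof.
apply: (big_morph (fun X : bop H => dotp (X x) y)) => [X Y|].
  by rewrite -dotpDl.
exact: dotp0l.
Qed.

(** Positivity at [y + t *: x] has no quadratic term in [t], as its coefficient is [dotp (P x) x].
    What remains is affine in [t] and its conjugate, so both cross terms vanish. *)
Lemma op_positive_ker P x : op_positive P -> dotp (P x) x = 0 ->
  P x = 0 /\ forall y, dotp (P y) x = 0.
Proof.
move=> Ppos xx0.
suff cross y : dotp (P y) x = 0 /\ dotp (P x) y = 0.
  by split=> [|y]; [apply: dotp_eq0 => y|]; case: (cross y).
apply: (@affine_conj_ge0 _ (dotp (P y) y)) => t.
have := Ppos (y + t *: x).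
rewrite linearD linearZ /= !dotpDl !dotpDr !dotpZl !dotpZr xx0.
by rewrite !mulr0 addr0 addrA.
Qed.

End Operators.

(** * Completely positive maps on the kernel of their value at 1 *)

Section CompletelyPositiveKernel.
Variables (R : realType) (A : cstarAlgType R).

Lemma star0 : star (0 : A) = 0.
Proof.
have := starP (1 : R[i]) (0 : A) 0.
by rewrite scale1r addr0 rmorph1 scale1r => /(canLR (addrK _)); rewrite subrr.
Qed.

Lemma star1 : star (1 : A) = 1.
Proof. by have := starM (star (1 : A)) 1; rewrite mulr1 starK mulr1. Qed.

Variables (H : hilbertType R) (P : bop H) (Phi : {linear A -> bop H}).
Hypothesis PhiCP : CP P Phi.

Lemma CP_pair_ge0 (a : A) (x y : H) :
  0 <= dotp (P x) x + dotp (Phi a y) x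
       + (dotp (Phi (star a) x) y + dotp (Phi (star a * a) y) y).
Proof.
case: PhiCP => cp Phi1.
(* With rows [1, a] and [0, 0], the product [b^* b] is [[[1, a], [a^*, a^* a]]]. *)
pose b : 'M[A]_2 := \matrix_(i, j)
  if i == 0 then if j == 0 then 1 else a else 0.
have := cp 2%N _ (ex_intro _ b erefl) (fun i => if i == 0 then x else y).
rewrite !big_ord_recl !big_ord0 !addr0 !mxE !big_ord_recl !big_ord0 !mxE /=.
by rewrite star1 star0 !mul0r !addr0 !mul1r mulr1 Phi1.
Qed.

(** At [t *: x] and [y] the inequality of [CP_pair_ge0] loses its quadratic term in [t], whose
    coefficient is [dotp (P x) x]. *)
Lemma CP_ker (a : A) (x : H) : P x = 0 ->
  Phi a x = 0 /\ forall y, dotp (Phi a y) x = 0.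
Proof.
move=> Px0.
suff cross b y : dotp (Phi b y) x = 0 /\ dotp (Phi (star b) x) y = 0.
  split=> [|y]; last by case: (cross a y).
  by apply: dotp_eq0 => y; rewrite -(starK a); case: (cross (star a) y).
apply: (@affine_conj_ge0 _ (dotp (Phi (star b * b) y) y)) => t.
have := CP_pair_ge0 b (t *: x) y.
rewrite !linearZ /= Px0 scaler0 dotp0l add0r dotpZl dotpZr.
by rewrite addrA addrC.
Qed.

End CompletelyPositiveKernel.

(** * Block operators for a closed subspace and its complement *)

Section Blocks.
Variables (R : realType) (H : hilbertType R) (S : closedSubspace H).
Local Notation p := (@orthproj R H S).
Implicit Types (x y : H) (u v : csub S) (X Y : bop (csub S)) (T : bop H).

Lemma orthproj_val u : p (val u) = u.
Proof. by apply: orthproj_uniq => z; rewrite subrr dotp0l. Qed.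

Lemma dotp_orthproj x u : dotp (p x) u = dotp x (val u).
Proof.
apply/eqP; rewrite -subr_eq0 -[X in _ - X](subrK (dotp (val (p x)) (val u))).
by rewrite -dotpBl orthprojP add0r subrr.
Qed.

Lemma dotp_orthprojr x u : dotp (val u) x = dotp u (p x).
Proof. by rewrite dotpC [RHS]dotpC dotp_orthproj. Qed.

HB.instance Definition _ :=
  GRing.isLinear.Build R[i] H (csub S) *:%R p (orthproj_linear S).

Lemma orthproj_compl x : p (x - val (p x)) = 0.
Proof. by rewrite linearB /= orthproj_val subrr. Qed.

Fact diag_subproof (c : R[i]) X :
  (fun x => val (X (p x)) + c *: (x - val (p x))) \in @bounded_linear R H.
Proof.
apply/bounded_linearP; split=> [a x y|].
  rewrite !linearP /= addrACA -scalerDr [c *: (_ + _)]scalerDr.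
  by rewrite !scalerA mulrC -scalerA addrACA -scalerDr.
have [M XM] := bop_bounded X.
exists (`|M| + `|c| * 2) => x.
rewrite (le_trans (ler_normD _ _)) // mulrDl lerD //.
  rewrite -csub_normE (le_trans (XM _)) //.
  have [->|px0] := eqVneq (p x) 0; first by rewrite normr0 mulr0 mulr_ge0.
  have M0 : 0 <= M.
    by have := le_trans (normr_ge0 _) (XM (p x)); rewrite pmulr_lge0 ?normr_gt0.
  by rewrite ger0_norm // ler_wpM2l // orthproj_norm.
rewrite normrZ -mulrA ler_wpM2l // mulr_natl mulr2n.
by rewrite (le_trans (ler_normB _ _)) // lerD2l -csub_normE orthproj_norm.
Qed.

(* The block operator [[X, 0], [0, c]]. *)
Definition diag c X : bop H := Bop (diag_subproof c X).

Lemma diagE c X x : diag c X x = val (X (p x)) + c *: (x - val (p x)).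
Proof. by []. Qed.

Lemma diag0_linear : linear (diag 0).
Proof.
move=> a X Y; apply: bop_eq => x; rewrite bopD bopZ !diagE !scale0r !addr0.
by rewrite bopD bopZ.
Qed.

HB.instance Definition _ := GRing.isLinear.Build R[i] (bop (csub S)) (bop H)
  *:%R (diag 0) diag0_linear.

Lemma orthproj_diag c X x : p (diag c X x) = X (p x).
Proof.
by rewrite diagE linearD linearZ /= orthproj_compl scaler0 addr0 orthproj_val.
Qed.

Lemma dotp_diag0 X x y : dotp (diag 0 X x) y = dotp (X (p x)) (p y).
Proof. by rewrite diagE scale0r addr0 dotp_orthprojr. Qed.

Lemma dotp_compress T u v : dotp (compress S T u) v = dotp (T (val u)) (val v).
Proof. exact: dotp_orthproj. Qed.

Lemma diag0K : cancel (diag 0) (compress S).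
Proof.
by move=> X; apply: bop_eq => u /=; rewrite orthproj_diag orthproj_val.
Qed.

(** The lower entry 1, there to keep [diag 1 X] invertible, only meets the zero block of
    [diag 0 Y]. *)
Lemma Ad_diag1 X Y : Ad (diag 1 X) (diag 0 Y) = diag 0 (Ad X Y).
Proof.
apply: bop_dotp_eq => x y.
by rewrite dotp_Ad !dotp_diag0 dotp_Ad !orthproj_diag.
Qed.

(** The form of [diag 0 X] sees both arguments only through [p], so on [S] just the upper left block
    of [T] enters. *)
Lemma compress_Ad T X : compress S (Ad T (diag 0 X)) = Ad (compress S T) X.
Proof.
by apply: bop_dotp_eq => x y; rewrite dotp_compress !dotp_Ad dotp_diag0.
Qed.

Lemma diag1_invertible X : op_invertible X -> op_invertible (diag 1 X).
Proof.
case=> Y [XY YX]; exists (diag 1 Y).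
by split=> x; rewrite diagE orthproj_diag ?XY ?YX diagE scale1r addrAC subrr
  add0r scale1r addrC subrK.
Qed.

(* In block form T = [[a, 0], [c, d]]; the upper left block of its inverse is
   only a right inverse of a, so injectivity of a must come from elsewhere. *)
Lemma compress_invertible T : op_invertible T ->
  (forall x, p x = 0 -> p (T x) = 0) ->
  ((forall u, exists v, compress S T v = u) ->
     forall u, compress S T u = 0 -> u = 0) ->
  op_invertible (compress S T).
Proof.
case=> T' [TT' T'T] low inj.
have right_inv : cancel (compress S T') (compress S T).
  move=> u /=; apply/eqP; rewrite -subr_eq0; apply/eqP.
  (* Write [val u] as [T (T' (val u))]: compressing [T'] changes the argument of [T] by a vector
     that [p] kills. *)
  rewrite -[X in _ - X]orthproj_val -linearB -[val u]T'T -linearB /=.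
  by apply: low; rewrite linearB /= orthproj_val subrr.
exists (compress S T'); split=> // u; apply/eqP; rewrite -subr_eq0; apply/eqP.
apply: inj => [v|]; first by exists (compress S T' v).
by rewrite linearB /= [X in X - _](right_inv (compress S T u)) subrr.
Qed.

Variable A : cstarAlgType R.

Lemma compress_cp (Phi : {linear A -> bop H}) :
  completely_positive Phi -> completely_positive (compress S \o Phi).
Proof.
move=> cp n a a0 x; have := cp n a a0 (fun i => val (x i)).
rewrite (eq_bigr (fun i => \sum_(j < n)
  dotp ((map_mx (compress S \o Phi) a) i j (x j)) (x i))) // => i _.
by apply: eq_bigr => j _; rewrite !mxE dotp_compress.
Qed.

Lemma diag0_cp (Phi : {linear A -> bop (csub S)}) :
  completely_positive Phi -> completely_positive (diag 0 \o Phi).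
Proof.
move=> cp n a a0 x; have := cp n a a0 (fun i => p (x i)).
rewrite (eq_bigr (fun i => \sum_(j < n)
  dotp ((map_mx (diag 0 \o Phi) a) i j (x j)) (x i))) // => i _.
by apply: eq_bigr => j _; rewrite !mxE dotp_diag0.
Qed.

End Blocks.

(** * The closed range of [P] and the block form of [Phi] *)

Section RangeClosureBlocks.
Variables (R : realType) (H : hilbertType R) (P : bop H).
Hypothesis Ppos : op_positive P.
Local Notation H0 := (range_closure P).
Local Notation p := (@orthproj R H H0).

(** Such a [u] is orthogonal to the range of [P]. If it were nonzero, some [P y] would be closer to
    it than [|u|], and Cauchy-Schwarz for [dotp (u - P y) u] would give [|u|^2 < |u|^2]. *)
Lemma range_closure_ker_eq0 (u : csub H0) : P (val u) = 0 -> u = 0.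
Proof.
move=> Pu0; apply/eqP; apply: contraT => u0.
have pos : 0 < `|u| by rewrite normr_gt0.
have /set_mem clu : val u \in csub_set H0 by exact: valP u.
have [_ [[y _ <-]]] := clu _ (nbhsx_ballx (val u) _ pos).
rewrite -ball_normE /= => near.
have Pyu : dotp (P y) (val u) = 0.
  by apply: (op_positive_ker Ppos _).2; rewrite Pu0 dotp0l.
suff : `|u| ^+ 2 < `|u| ^+ 2 by rewrite ltxx.
have -> : `|u| ^+ 2 < `|u| ^+ 2 = (`|dotp (val u - P y) (val u)| < `|u| * `|u|).
  by rewrite dotpBl Pyu subr0 dotpxx normrX normr_id.
by rewrite (le_lt_trans (cauchy_schwarz _ _)) // ltr_pM2r.
Qed.

Lemma orthproj_range_eq0 x : p x = 0 <-> P x = 0.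
Proof.
have px0_Px0 y : p y = 0 -> P y = 0.
  move=> py0; apply: (op_positive_ker Ppos _).1.
  have PyH0 : P y \in @csub_pred _ _ H0.
    by apply: mem_set; apply: subset_closure; exists y.
  rewrite -[P y]/(val (Csub PyH0 : csub H0)) dotp_orthprojr py0.
  by rewrite dotp0r.
split=> [|Px0]; first exact: px0_Px0.
apply: range_closure_ker_eq0.
by rewrite -[val _](subKr x) linearB /= Px0 px0_Px0 ?subrr ?orthproj_compl.
Qed.

(** By [CP_ker], [Phi a] kills the kernel of [P], which is the complement of [H0], and takes values
    orthogonal to it. *)
Lemma CP_blocks (A : cstarAlgType R) (Phi : {linear A -> bop H}) :
  CP P Phi -> forall a, diag 0 (compress H0 (Phi a)) = Phi a.
Proof.
move=> PhiP a; apply: bop_eq => x; rewrite diagE scale0r addr0 /=.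
have compl y : P (y - val (p y)) = 0.
  by apply/orthproj_range_eq0; exact: orthproj_compl.
have -> : Phi a (val (p x)) = Phi a x.
  apply/eqP; rewrite eq_sym -subr_eq0 -linearB /=; apply/eqP.
  by rewrite (CP_ker PhiP a (compl x)).1.
set w := Phi a x; apply/eqP; rewrite eq_sym -subr_eq0 -normr_eq0 -sqrf_eq0.
rewrite -dotpxx dotpBl dotp_orthprojr orthproj_compl dotp0r subr0.
by rewrite (CP_ker PhiP a (compl w)).2.
Qed.

Lemma orthproj_range_dotp_eq0 x : dotp (P x) x = 0 -> p x = 0.
Proof. by move=> /(op_positive_ker Ppos)[/orthproj_range_eq0]. Qed.

End RangeClosureBlocks.

(** * Surjective endomorphisms in finite dimension *)

Section FiniteDimension.
Variables (K : fieldType) (V : lmodType K).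

Definition spanning n (e : 'I_n -> V) :=
  forall x, exists c : 'I_n -> K, x = \sum_(i < n) c i *: e i.

(* A nonzero kernel vector makes one element of the image of a spanning family
   redundant, against minimality of the family. *)
Lemma surjective_linear_injective (f : {linear V -> V}) :
  (exists n (e : 'I_n -> V), spanning e) ->
  (forall y, exists x, f x = y) -> forall x, f x = 0 -> x = 0.
Proof.
move=> fin surj x fx0.
have fin' : exists n, `[< exists e : 'I_n -> V, spanning e >].
  by case: fin => n en; exists n; apply/asboolP.
case: (ex_minnP fin') => n /asboolP[e span_e] nmin.
have [c xc] := span_e x.
have [c0|] := pselect (forall i, c i = 0).
  by rewrite xc big1 // => i _; rewrite c0 scale0r.
move=> /existsNP[i0 /eqP ci0]; exfalso.
case: n e span_e nmin c xc i0 ci0 => [|n] e span_e nmin c xc i0 ci0.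
  by case: i0 {ci0}.
suff : (n.+1 <= n)%N by rewrite ltnn.
apply: nmin; apply/asboolP; exists (fun i => f (e (lift i0 i))) => y.
have [z <-] := surj y; have [d zd] := span_e z.
(* Subtracting [d i0 / c i0] times the kernel vector [x] from [z] keeps [f z] and removes the
   coordinate at [i0]. *)
exists (fun i => d (lift i0 i) - d i0 / c i0 * c (lift i0 i)).
have -> : f z = f (z - (d i0 / c i0) *: x).
  by rewrite linearB linearZ /= fx0 scaler0 subr0.
rewrite xc zd scaler_sumr -sumrB linear_sum (bigD1_ord i0) //=.
rewrite !scalerA divfK // subrr linear0 add0r; apply: eq_bigr => i _.
by rewrite scalerA -scalerBl linearZ.
Qed.

End FiniteDimension.

Lemma finite_dimensional_csub (R : realType) (H : hilbertType R)
    (S : closedSubspace H) :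
  finite_dimensional H -> exists n (e : 'I_n -> csub S), spanning e.
Proof.
case=> n [e He]; exists n, (fun i => orthproj S (e i)) => u.
have [c uc] := He (val u); exists c.
rewrite -[LHS]orthproj_val uc linear_sum.
by apply: eq_bigr => i _; rewrite linearZ.
Qed.

(** * Transfer of extremality between [H] and the closed range *)

Theorem proposition3p17 (R : realType) (A : cstarAlgType R) (H : hilbertType R)
    (P : bop H) (Phi : {linear A -> bop H}) :
  P <> 0 -> op_positive P -> (exists x : H, P x = 0 /\ x <> 0) -> CP P Phi ->
  let H0 := range_closure P in
  let P0 : bop (csub H0) := compress H0 P in
  let Phi0 : {linear A -> bop (csub H0)} := compress H0 \o Phi in
  (Cstar_extreme P Phi -> Cstar_extreme P0 Phi0) /\
  (finite_dimensional H -> Cstar_extreme P0 Phi0 -> Cstar_extreme P Phi).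
Proof.
move=> _ Ppos _ PhiP H0 P0 Phi0.
have PE : diag 0 P0 = P by rewrite /P0 -PhiP.2 CP_blocks.
have PhiE a : diag 0 (Phi0 a) = Phi a by rewrite /Phi0 /= CP_blocks.
split=> [[_ ext]|fd [_ ext]]; split=> //.
- split; first exact: compress_cp PhiP.1.
  by rewrite /Phi0 /= PhiP.2.
- move=> n Psis T n0 PsisP Tinv TP TPhi.
  pose Phis j : {linear A -> bop H} := diag 0 \o Psis j.
  have PhisP j : CP P (Phis j).
    split; first exact: diag0_cp (PsisP j).1.
    by rewrite /Phis /= (PsisP j).2.
  have [] := ext n Phis (fun j => diag 1 (T j)) n0 PhisP.
  + by move=> j; exact: diag1_invertible.
  + rewrite -[RHS]PE -TP linear_sum.
    by apply: eq_bigr => j _; rewrite -PE Ad_diag1.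
  + move=> a; rewrite -PhiE TPhi linear_sum.
    by apply: eq_bigr => j _; rewrite Ad_diag1.
  move=> S HS; exists (fun j => compress H0 (S j)) => j.
  have [Sinv SPhi] := HS j; split; last first.
    by move=> a; rewrite -compress_Ad PhiE -SPhi diag0K.
  (* Evaluating [SPhi] at 1 gives [Ad (S j) P = P]. *)
  have SP x : dotp (P x) x = dotp (P (S j x)) (S j x).
    by rewrite -dotp_Ad -{2}PhiP.2 -SPhi (PhisP j).2.
  apply: compress_invertible => // [x /(orthproj_range_eq0 Ppos) Px0|_ u Su0].
    apply: orthproj_range_dotp_eq0 => //.
    by rewrite -SP Px0 dotp0l.
  (* If the compression kills [u], then [P] kills [S j u], so [SP] makes the form of [P] vanish at
     [u]. *)
  apply: (range_closure_ker_eq0 Ppos); apply: (op_positive_ker Ppos _).1.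
  have /(orthproj_range_eq0 Ppos) PSu : orthproj H0 (S j (val u)) = 0 by [].
  by rewrite SP PSu dotp0l.
- move=> n Phis T n0 PhisP Tinv TP TPhi.
  pose Psis j : {linear A -> bop (csub H0)} := compress H0 \o Phis j.
  have PhisE j a : diag 0 (Psis j a) = Phis j a by rewrite /Psis /= CP_blocks.
  have [||||S HS] := ext n Psis (fun j => compress H0 (T j)) n0.
  + move=> j; split; first exact: compress_cp (PhisP j).1.
    by rewrite /Psis /= (PhisP j).2.
  + move=> j; apply: compress_invertible => // [x|surj].
      move=> /(orthproj_range_eq0 Ppos) Px0.
      apply: (orthproj_range_dotp_eq0 Ppos).
      (* The sum is [dotp (P x) x]; its terms are nonnegative, so each one vanishes. *)
      have : \sum_(j < n) dotp (P (T j x)) (T j x) = 0.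
        under eq_bigr do rewrite -dotp_Ad.
        by rewrite -dotp_sum TP Px0 dotp0l.
      by move/psumr_eq0P => ->.
    exact: surjective_linear_injective (finite_dimensional_csub H0 fd) surj.
  + rewrite -[RHS]/(compress H0 P) -TP linear_sum.
    by apply: eq_bigr => j _; rewrite -compress_Ad PE.
  + move=> a; rewrite /Phi0 /= TPhi linear_sum.
    by apply: eq_bigr => j _; rewrite -compress_Ad PhisE.
  exists (fun j => diag 1 (S j)) => j; have [Sinv SPhi] := HS j.
  split=> [|a]; first exact: diag1_invertible.
  by rewrite -PhiE Ad_diag1 -SPhi PhisE.
Qed.
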